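(* Let $C$ be an arithmetic circuit with $s$ gates. The compiled $\mathrm{ARM}(3)$ instance $\mathcal{I}(C)$ described in the context has $O(s)$ designated carriers and $O(s)$ affine constraints.
   Context: Notation: $[m]=\{1,\dots,m\}$; $X[I,J]$ is the submatrix of $X$ with rows in $I$ and columns in $J$. $\mathrm{ARM}(3)$: given rational affine constraints $\langle A_\ell,X\rangle=b_\ell$ on $X\in\mathbb{R}^{m\times n}$ (with $\langle A,X\rangle=\sum_{i,j}A_{ij}X_{ij}$), decide whether some $X$ satisfies them with $\operatorname{rank}(X)\le 3$. Arithmetic circuit: a finite directed acyclic graph with input gates (labelled by real variables), constant gates (labelled by $c\in\mathbb{Q}$), fan-in-2 gates $+$ and $\times$, fan-in-1 negation gates, and a designated output gate $g_{\mathrm{out}}$. Compiled instance $\mathcal{I}(C)$. There is one matrix variable $X\in\mathbb{R}^{m\times n}$, with the following affine constraints. (a) Gauge: for fixed $I_0\subseteq[m]$, $J_0\subseteq[n]$ of size 3 and a fixed rational $B\in\mathbb{R}^{3\times 3}$ with $\det B\ne 0$ (e.g. $B=I_3$), $X[I_0,J_0]=B$. (b) Carriers: every occurrence of a circuit value (a gate's output, and each use of a value as an input of a gate) is given its own designated carrier position $(r,c)$; the value of the occurrence is decoded as $X_{r,c}$. For occurrences representing the same circuit value, equality is enforced by copy constraints $X_{r,c}=X_{r',c'}$ (one linking each use to the producing gate's output carrier). (c) Gadgets: for each gate, a gadget acting on the carriers of its own inputs and output. Constant gate $z=c$: $X_{r_z,c_z}=c$. Addition $z=x+y$: $X_{r_z,c_z}-X_{r_x,c_x}-X_{r_y,c_y}=0$.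 Negation $z=-x$: $X_{r_z,c_z}+X_{r_x,c_x}=0$. Multiplication $z=xy$: for row indices $r_1\neq r_2$ and column indices $c_1\ne c_2$ of the gadget, $X[\{r_1,r_2\},\{c_1,c_2\}]=\begin{pmatrix}1&x\\ y&z\end{pmatrix}$, i.e. $X_{r_1,c_1}=1$ and $X_{r_1,c_2},X_{r_2,c_1},X_{r_2,c_2}$ carry $x,y,z$ respectively; other entries are unconstrained by the gadget. (d) Output: $X_{r_{\mathrm{out}},c_{\mathrm{out}}}=0$ for the carrier of $g_{\mathrm{out}}$. Apart from $I_0$ and $J_0$, distinct gadgets use disjoint sets of (fresh) row indices and disjoint sets of (fresh) column indices, $O(1)$ of each per gadget. *)

(* Defs.v *)
From mathcomp Require Import all_boot all_order all_algebra.
From mathcomp Require Import reals.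

Set Implicit Arguments.
Unset Strict Implicit.
Unset Printing Implicit Defensive.
Import Order.TTheory GRing.Theory Num.Theory.
Local Open Scope ring_scope.

(* The pair (A, b) is the constraint <A, X> = b. *)
Definition affine_constraint (m n : nat) : Type := ('M[rat]_(m, n) * rat)%type.

Record arm_instance := ArmInstance {
  arm_rows : nat;
  arm_cols : nat;
  arm_constraints : seq (affine_constraint arm_rows arm_cols) }.

Definition mxinner (R : realType) (m n : nat) (A : 'M[rat]_(m, n))
    (X : 'M[R]_(m, n)) : R :=
  \sum_i \sum_j ratr (A i j) * X i j.

Definition satisfies (R : realType) (m n : nat) (X : 'M[R]_(m, n))
    (c : affine_constraint m n) : Prop :=
  mxinner c.1 X = ratr c.2.

Definition ARM3 (R : realType) (I : arm_instance) : Prop :=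
  exists2 X : 'M[R]_(arm_rows I, arm_cols I),
    (forall k, (k < size (arm_constraints I))%N ->
       satisfies X (nth (0, 0) (arm_constraints I) k))
    & (\rank X <= 3)%N.

(* [G] is the type of gate names; [Input v] is labelled by the variable of
   index [v]. *)
Inductive gate (G : Type) : Type :=
| Input of nat
| Const of rat
| Add of G & G
| Mul of G & G
| Neg of G.

Arguments Input {G} _.
Arguments Const {G} _.

Definition gate_inputs (G : Type) (l : gate G) : seq G :=
  match l with
  | Input _ | Const _ => [::]
  | Add a b | Mul a b => [:: a; b]
  | Neg a => [:: a]
  end.

Definition wire (s : nat) (label : 'I_s -> gate 'I_s) : rel 'I_s :=
  fun h g => h \in gate_inputs (label g).

Record circuit (s : nat) := Circuit {
  label : 'I_s -> gate 'I_s;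
  g_out : 'I_s;
  (* [connect] is reflexive, so this also rules out self-loops. *)
  label_acyclic : forall h g : 'I_s,
    wire label h g -> ~~ connect (wire label) g h }.

(* The slot [None] of a gate is its output; [Some false] and [Some true] are
   its first and second input.  The slots of [g] that exist are its output and
   as many inputs as its fan-in (in the comparison, [false] is 0 and [true]
   is 1). *)
Definition occurrences (s : nat) (C : circuit s) : {set 'I_s * option bool} :=
  [set o : 'I_s * option bool |
     if o.2 is Some i then (i < size (gate_inputs (label C o.1)))%N else true].

(* The choices left open by the compilation: the gauge, the carriers, and the
   fresh rows and columns of each gadget, at most [k] of each.  Values of
   [pos] outside [occurrences C], and of [r1 r2 c1 c2] outside multiplication
   gates, are irrelevant. *)
Record layout (k s : nat) (C : circuit s) := Layout {
  lm : nat;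
  ln : nat;
  I0 : {set 'I_lm};
  J0 : {set 'I_ln};
  card_I0 : #|I0| = 3;
  card_J0 : #|J0| = 3;
  gaugeB : 'M[rat]_3;
  det_gaugeB : \det gaugeB != 0;
  gadget_rows : 'I_s -> {set 'I_lm};
  gadget_cols : 'I_s -> {set 'I_ln};
  card_gadget_rows : forall g, (#|gadget_rows g| <= k)%N;
  card_gadget_cols : forall g, (#|gadget_cols g| <= k)%N;
  gadget_rows_fresh : forall g, [disjoint gadget_rows g & I0];
  gadget_cols_fresh : forall g, [disjoint gadget_cols g & J0];
  gadget_rows_disjoint : forall g h, g != h ->
    [disjoint gadget_rows g & gadget_rows h];
  gadget_cols_disjoint : forall g h, g != h ->
    [disjoint gadget_cols g & gadget_cols h];
  pos : 'I_s * option bool -> 'I_lm * 'I_ln;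
  pos_inj : {in occurrences C &, injective pos};
  pos_in_gadget : forall o, o \in occurrences C ->
    (pos o).1 \in gadget_rows o.1 /\ (pos o).2 \in gadget_cols o.1;
  r1 : 'I_s -> 'I_lm;
  r2 : 'I_s -> 'I_lm;
  c1 : 'I_s -> 'I_ln;
  c2 : 'I_s -> 'I_ln;
  mul_gadget : forall g a b, label C g = Mul a b ->
    [/\ r1 g != r2 g /\ c1 g != c2 g,
        [/\ r1 g \in gadget_rows g, r2 g \in gadget_rows g,
            c1 g \in gadget_cols g & c2 g \in gadget_cols g],
        pos (g, Some false) = (r1 g, c2 g),
        pos (g, Some true) = (r2 g, c1 g)
      & pos (g, None) = (r2 g, c2 g)] }.

Section Compile.
Variables (k s : nat) (C : circuit s) (L : layout k C).

Local Notation constraint := (affine_constraint (lm L) (ln L)).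

Definition carriers : {set 'I_(lm L) * 'I_(ln L)} := pos L @: occurrences C.

(* <entry p, X> = X p.1 p.2 *)
Definition entry (p : 'I_(lm L) * 'I_(ln L)) : 'M[rat]_(lm L, ln L) :=
  delta_mx p.1 p.2.

Local Notation x_ g := (entry (pos L (g, Some false))).
Local Notation y_ g := (entry (pos L (g, Some true))).
Local Notation z_ g := (entry (pos L (g, None))).

(* [enum_val] lists the elements of a set of indices in increasing order. *)
Definition gauge_row (i : 'I_3) : 'I_(lm L) :=
  enum_val (cast_ord (esym (card_I0 L)) i).
Definition gauge_col (j : 'I_3) : 'I_(ln L) :=
  enum_val (cast_ord (esym (card_J0 L)) j).

Definition gauge_constraints : seq constraint :=
  [seq (entry (gauge_row i, gauge_col j), gaugeB L i j)
     | i <- enum 'I_3, j <- enum 'I_3].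

Definition copy_constraints (g : 'I_s) : seq constraint :=
  match label C g with
  | Input _ | Const _ => [::]
  | Add a b | Mul a b => [:: (x_ g - z_ a, 0); (y_ g - z_ b, 0)]
  | Neg a => [:: (x_ g - z_ a, 0)]
  end.

(* For a multiplication gate, x, y and z already sit at the prescribed
   positions by [mul_gadget]. *)
Definition gadget_constraints (g : 'I_s) : seq constraint :=
  match label C g with
  | Input _ => [::]
  | Const c => [:: (z_ g, c)]
  | Add _ _ => [:: (z_ g - x_ g - y_ g, 0)]
  | Mul _ _ => [:: (entry (r1 L g, c1 L g), 1)]
  | Neg _ => [:: (z_ g + x_ g, 0)]
  end.

Definition output_constraint : constraint := (z_ (g_out C), 0).

Definition compile : arm_instance :=
  ArmInstance
    (gauge_constraints
     ++ flatten [seq copy_constraints g | g <- enum 'I_s]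
     ++ flatten [seq gadget_constraints g | g <- enum 'I_s]
     ++ [:: output_constraint]).

End Compile.

Lemma mxinner_entry (R : realType) (k s : nat) (C : circuit s)
    (L : layout k C) p (X : 'M[R]_(lm L, ln L)) :
  mxinner (entry p) X = X p.1 p.2.
Proof.
rewrite /mxinner (bigD1 p.1) //= (bigD1 p.2) //= !mxE !eqxx rmorph1 mul1r.
rewrite big1 ?addr0 => [|j /negPf nj]; last first.
  by rewrite mxE eqxx nj rmorph0 mul0r.
rewrite big1 ?addr0 // => i /negPf ni; rewrite big1 // => j _.
by rewrite mxE ni rmorph0 mul0r.
Qed.

(* Every circuit has a layout: 2 x 2 gadgets placed after a 3 x 3 gauge block. *)
Section LayoutExists.
Variables (s : nat) (C : circuit s).
Let m := (3 + s * 2)%N.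

Let idx (p : 'I_s * bool) : 'I_m :=
  rshift 3 (mxvec_index p.1 (if p.2 then ord_max else ord0 : 'I_2)).

Let idx_inj : injective idx.
Proof.
have [inv invK _] := curry_mxvec_bij s 2.
move=> [g b] [h c] /rshift_inj /= E.
have := invK (g, if b then ord_max else ord0) isT.
have := invK (h, if c then ord_max else ord0) isT.
by rewrite /= E => -> [-> /(congr1 val)]; case: b c {E} => [] [].
Qed.

Let block (g : 'I_s) : {set 'I_m} := [set idx (g, b) | b : bool].
Let base : {set 'I_m} := [set lshift (s * 2) i | i : 'I_3].

Let card_base : #|base| = 3.
Proof. by rewrite card_imset ?card_ord //; exact: lshift_inj. Qed.

Let card_block g : (#|block g| <= 2)%N.
Proof. by rewrite -card_bool leq_imset_card. Qed.

Let block_fresh g : [disjoint block g & base].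
Proof.
apply/pred0P => i /=; apply/negP => /andP[/imsetP[b _ ->] /imsetP[j _ /eqP]].
by rewrite eq_rlshift.
Qed.

Let block_disjoint g h : g != h -> [disjoint block g & block h].
Proof.
move=> /eqP gh; apply/pred0P => i /=; apply/negP.
by move=> /andP[/imsetP[b _ ->] /imsetP[c _ /idx_inj[]]].
Qed.

Let mem_block g b : idx (g, b) \in block g.
Proof. exact: imset_f. Qed.

Lemma layout_exists : inhabited (layout 2 C).
Proof.
pose p (o : 'I_s * option bool) : 'I_m * 'I_m :=
  (idx (o.1, o.2 != Some false), idx (o.1, o.2 != Some true)).
have p_inj : {in occurrences C &, injective p}.
  move=> [g i] [h j] _ _ /pair_equal_spec[/= /idx_inj[-> e1] /idx_inj[e2]].
  by case: i j e1 e2 => [[]|] [[]|].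
have p_in o : o \in occurrences C ->
    (p o).1 \in block o.1 /\ (p o).2 \in block o.1.
  by move=> _; split; exact: mem_block.
have det1_neq0 : \det (1%:M : 'M[rat]_3) != 0 by rewrite det1.
have p_mul g a b : label C g = Mul a b ->
    [/\ idx (g, false) != idx (g, true) /\ idx (g, false) != idx (g, true),
        [/\ idx (g, false) \in block g, idx (g, true) \in block g,
            idx (g, false) \in block g & idx (g, true) \in block g],
        p (g, Some false) = (idx (g, false), idx (g, true)),
        p (g, Some true) = (idx (g, true), idx (g, false))
      & p (g, None) = (idx (g, true), idx (g, true))].
  have ne : idx (g, false) != idx (g, true).
    by apply/eqP => /idx_inj[].
  by split; [ | split; exact: mem_block | | |].
exact: (inhabits (@Layout 2 s C m m base base card_base card_base 1%:M
  det1_neq0 block block card_block card_block block_fresh block_fresh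
  block_disjoint block_disjoint p p_inj p_in
  (fun g => idx (g, false)) (fun g => idx (g, true))
  (fun g => idx (g, false)) (fun g => idx (g, true)) p_mul)).
Qed.

End LayoutExists.

(* Main.v *)
Require Import Defs.
From mathcomp Require Import all_boot all_order all_algebra.
From mathcomp Require Import reals zify.

(* Each gate has at most three occurrences, two copy constraints and one gadget
   constraint.  The gauge (9) and the output (1) are absorbed into a multiple
   of s because a circuit has an output gate, so s >= 1: K = 9 + 2 + 1 + 1. *)

(** Turns a per-gate bound into a bound over all gates; used with [d] = 2 for the copies and [d] = 1
    for the gadgets. *)
Lemma size_flatten_map_le (S T : Type) (f : S -> seq T) (d : nat)
    (r : seq S) :
  (forall x, size (f x) <= d)%N -> (size (flatten (map f r)) <= d * size r)%N.
Proof.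
move=> fd; elim: r => [|x r IHr] //=.
by rewrite size_cat mulnS leq_add.
Qed.

Lemma circuit_gt0 (s : nat) (C : circuit s) : (0 < s)%N.
Proof. by apply: leq_ltn_trans (ltn_ord (g_out C)). Qed.

Lemma card_carriers_le (k s : nat) (C : circuit s) (L : layout k C) :
  (#|carriers L| <= 3 * s)%N.
Proof.
(* The carriers are an image of a subset of ['I_s * option bool], which has s * 3 elements. *)
apply: leq_trans (leq_imset_card _ _) _; apply: leq_trans (max_card _) _.
by rewrite card_prod card_option card_bool card_ord mulnC.
Qed.

Lemma size_gauge_constraints (k s : nat) (C : circuit s) (L : layout k C) :
  size (gauge_constraints L) = 9.
Proof. by rewrite size_allpairs size_enum_ord. Qed.

Lemma size_copy_constraints_le (k s : nat) (C : circuit s) (L : layout k C) g :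
  (size (copy_constraints L g) <= 2)%N.
Proof. by rewrite /copy_constraints; case: label. Qed.

Lemma size_gadget_constraints_le (k s : nat) (C : circuit s) (L : layout k C)
    g :
  (size (gadget_constraints L g) <= 1)%N.
Proof. by rewrite /gadget_constraints; case: label. Qed.

(** The summands follow the concatenation in [compile] (gauge, copies, gadgets, output), so they are
    compared block by block. *)
Lemma size_compile_le (k s : nat) (C : circuit s) (L : layout k C) :
  (size (arm_constraints (compile L)) <= 9 + (2 * s + (s + 1)))%N.
Proof.
have copies := size_flatten_map_le _ _ _ _ (enum 'I_s)
  (size_copy_constraints_le _ _ _ L).
have gadgets := size_flatten_map_le _ _ _ _ (enum 'I_s)
  (size_gadget_constraints_le _ _ _ L).
rewrite !size_enum_ord mul1n in copies gadgets.
by rewrite !size_cat size_gauge_constraints leq_add2l leq_add ?leq_add2r.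
Qed.

Theorem lemma7p1 :
  forall k : nat, exists K : nat,
    forall (s : nat) (C : circuit s) (L : layout k C),
      (#|carriers L| <= K * s)%N /\
      (size (arm_constraints (compile L)) <= K * s)%N.
Proof.
move=> k; exists 13 => s C L; split.
  by apply: leq_trans (card_carriers_le _ _ _ L) _; rewrite leq_mul2r orbT.
(* As s >= 1, the constant part 9 + 1 is at most 10 * s, which leaves 3 * s + 10 <= 13 * s. *)
by have := size_compile_le _ _ _ L; have := circuit_gt0 _ C; lia.
Qed.
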